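(* Let $G$ be a finite simple $2$-connected graph. If $G$ is $\{K_{1,3},N\}$-heavy, then $G$ is Hamiltonian.
   Context: Let $G$ be a graph on $n$ vertices. An induced subgraph $H'$ of $G$ is called heavy if there exist two nonadjacent vertices in $H'$ whose degree sum in $G$ is at least $n$. For a graph $H$, $G$ is $H$-heavy if every induced subgraph of $G$ isomorphic to $H$ is heavy; for a family $\mathcal{H}$ of graphs, $G$ is $\mathcal{H}$-heavy if it is $H$-heavy for every $H\in\mathcal{H}$. $K_{1,3}$ is the claw (a star with three leaves). $N$ (the ''net'') is the graph on 6 vertices obtained from a triangle by attaching one pendant edge at each of its three vertices. *)

(* Defs.v *)
From mathcomp Require Import all_boot.
Set Implicit Arguments. Unset Strict Implicit. Unset Printing Implicit Defensive.

Record sgraph := SGraph {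
  vertex :> finType;
  adj : rel vertex;
  adj_sym : symmetric adj;
  adj_irr : irreflexive adj }.

Definition degree (G : sgraph) (x : G) : nat := #|[set y | adj x y]|.

Section Induced.
Variables (G : sgraph) (S : {set G}).

Definition induced_adj : rel {x : G | x \in S} :=
  fun x y => adj (val x) (val y).

Lemma induced_adj_sym : symmetric induced_adj.
Proof. by move=> x y; rewrite /induced_adj adj_sym. Qed.

Lemma induced_adj_irr : irreflexive induced_adj.
Proof. by move=> x; rewrite /induced_adj adj_irr. Qed.

Definition induced : sgraph := SGraph induced_adj_sym induced_adj_irr.
End Induced.

Definition isomorphic (G H : sgraph) : Prop :=
  exists2 f : G -> H, bijective f & forall x y, adj (f x) (f y) = adj x y.

Definition connected (G : sgraph) : Prop :=
  forall x y : G, connect (@adj G) x y.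

Definition k_connected (k : nat) (G : sgraph) : Prop :=
  k < #|G| /\ forall S : {set G}, #|S| < k -> connected (induced (~: S)).

(* [ucycle] accepts sequences of length at most 2 (an edge traversed back and
   forth, for instance), hence the bound on the size. *)
Definition hamiltonian (G : sgraph) : Prop :=
  exists c : seq G, [/\ 2 < size c, ucycle (@adj G) c & forall x, x \in c].

Definition heavy (G : sgraph) (S : {set G}) : Prop :=
  exists x y : G, [/\ x \in S, y \in S, x != y, ~~ adj x y
                    & #|G| <= degree x + degree y].

Definition is_heavy (G H : sgraph) : Prop :=
  forall S : {set G}, isomorphic (induced S) H -> heavy S.

Definition family_heavy (G : sgraph) (F : sgraph -> Prop) : Prop :=
  forall H, F H -> is_heavy G H.

Section CompleteBipartite.
Variables m n : nat.

Definition Kmn_adj : rel ('I_m + 'I_n)%type := fun x y =>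
  match x, y with
  | inl _, inr _ | inr _, inl _ => true
  | _, _ => false
  end.

Lemma Kmn_adj_sym : symmetric Kmn_adj.
Proof. by case=> ? [] ?. Qed.

Lemma Kmn_adj_irr : irreflexive Kmn_adj.
Proof. by case. Qed.

Definition complete_bipartite : sgraph := SGraph Kmn_adj_sym Kmn_adj_irr.
End CompleteBipartite.

Definition claw : sgraph := complete_bipartite 1 3.

(* The vertices [(i, false)] form the triangle and [(i, true)] is the pendant
   vertex attached to [(i, false)]. *)
Definition net_adj : rel ('I_3 * bool)%type := fun x y =>
  if x.1 == y.1 then x.2 != y.2 else ~~ x.2 && ~~ y.2.

Lemma net_adj_sym : symmetric net_adj.
Proof. by move=> [i b] [j c]; rewrite /net_adj /= eq_sym [b == c]eq_sym andbC. Qed.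

Lemma net_adj_irr : irreflexive net_adj.
Proof. by move=> [i b]; rewrite /net_adj /= !eqxx. Qed.

Definition net : sgraph := SGraph net_adj_sym net_adj_irr.

(* Main.v *)
(** Call two vertices heavily adjacent if they are adjacent or their degrees sum
    to at least [n]; by the Bondy-Chvatal exchange, a cycle of heavy adjacencies
    yields a genuine cycle that is at least as long. Let [C] be a longest cycle
    and [P] a path outside [C] joining two vertices [u], [v] of [C].

    Grow a block around [u]: a segment of [C] that is extended at one end by a
    vertex with a second heavy neighbour in the block, or at both ends by two
    heavily adjacent vertices. Blocks have enough spanning systems of one or two
    paths that any short-cut out of them, combined with [P], lengthens [C]. If a
    block contains no nonadjacent pair of degree sum at least [n] then it can be
    extended, since otherwise its two neighbours on [C] and the first vertex of
    [P] are three pendant vertices, which force an induced claw or net without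
    heavy pair. So disjoint maximal blocks around [u] and [v] both contain a heavy
    pair; adding up the four degrees gives two heavy adjacencies between the
    blocks that share an end, while the possible ones form a matching. *)

Require Import Defs.
From mathcomp Require Import all_boot.
From mathcomp Require Import zify.
Set Implicit Arguments. Unset Strict Implicit. Unset Printing Implicit Defensive.

(** Two sequences are permutations of each other when they agree on the count of every predicate
    [f], which leaves linear arithmetic. *)
Ltac perm_count := let f := fresh "f" in
  repeat match goal with H : is_true (perm_eq _ _) |- _ => move/permP in H end;
  apply/permP => f;
  repeat match goal with H : count^~ _ =1 count^~ _ |- _ => move: {H}(H f) end;
  rewrite -?cats1 ?rev_cons -?cats1 ?(rev_cat, count_cat, count_rev) /=
          ?(count_cat, count_rev) /=; clear; lia.

Lemma head_rev (T : Type) (x : T) s : head x (rev s) = last x s.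
Proof. by case/lastP: s => // s y; rewrite rev_rcons last_rcons. Qed.

Lemma last_rev (T : Type) (x : T) s : last x (rev s) = head x s.
Proof. by rewrite -[in RHS](revK s) head_rev. Qed.

(** * Blocks and their spanning systems of one or two paths *)

Section Blocks.
Variables (T : eqType) (e : rel T).
Hypothesis e_sym : symmetric e.
Implicit Types (u v w x y z a b : T) (p q s t : seq T).

(** Both ends are listed in [p], so a duplicate-free walk from [x] to [x] is [[:: x]]; in [link],
    [L] holds inner vertices only and may be empty. *)
Definition walk x y p :=
  if p is z :: p' then [&& z == x, path e x p' & last x p' == y] else false.

Definition link x L y := path e x (rcons L y).

Lemma walk1 x : walk x x [:: x].
Proof. by rewrite /walk /= !eqxx. Qed.

Lemma walk_link x y z w p L q :
  walk x y p -> link y L z -> walk z w q -> walk x w (p ++ L ++ q).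
Proof.
case: p => // x' p /= /and3P[/eqP -> xp /eqP yp] Ll.
case: q => // z' q /= /and3P[/eqP -> zq /eqP wq].
rewrite eqxx cat_path xp yp /=.
move: Ll; rewrite /link rcons_path => /andP[yL Lz].
by rewrite cat_path yL /= Lz zq !last_cat /= wq eqxx.
Qed.

Lemma walk_cat x y z w p q :
  walk x y p -> e y z -> walk z w q -> walk x w (p ++ q).
Proof. by move=> xp yz; apply: (@walk_link x y z w p [::] q) => //; rewrite /link /= yz. Qed.

Lemma walk_rcons x y z p : walk x y p -> e y z -> walk x z (rcons p z).
Proof. by move=> xp yz; rewrite -cats1; apply: walk_cat xp yz (walk1 z). Qed.

Lemma walk_cons x y z p : walk x y p -> e z x -> walk z y (z :: p).
Proof. by move=> xp zx; rewrite -cat1s; apply: walk_cat (walk1 z) zx xp. Qed.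

Lemma link_rev x L y : link x L y -> link y (rev L) x.
Proof.
rewrite /link => h; have := rev_path e x (rcons L y).
rewrite last_rcons belast_rcons rev_cons => ->.
by rewrite (eq_path (e' := e)) // => i j; rewrite e_sym.
Qed.

Lemma link_cat x L y p z L' w :
  link x L y -> walk y z p -> link z L' w -> link x (L ++ p ++ L') w.
Proof.
rewrite /link; case: p => // y' p + /= /and3P[/eqP -> yp /eqP <-] zL'.
by rewrite rcons_path rcons_cat cat_path /= rcons_cat cat_path yp zL' => /andP[-> ->].
Qed.

Lemma walk_rev x y p : walk x y p -> walk y x (rev p).
Proof.
case: p => // x' p /= /and3P[/eqP -> xp /eqP <-].
case/lastP: p xp => [|p z] xp; first exact: walk1.
rewrite last_rcons rev_cons rev_rcons /= eqxx.
by rewrite last_rcons eqxx andbT; apply: link_rev.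
Qed.

Lemma cycle_walk x y p L : walk x y p -> link y L x -> cycle e (p ++ L).
Proof.
case: p => // x' p /= /and3P[/eqP -> xp /eqP yp] Ll.
by rewrite rcons_cat cat_path xp yp.
Qed.

(** For duplicate-free [s] this is a Hamiltonian path of [s] with prescribed ends; [spans2]
    partitions [s] into two such paths. *)
Definition spans1 s x y := exists2 p, walk x y p & perm_eq p s.

Definition spans2 s x y z w :=
  exists p q, [/\ walk x y p, walk z w q & perm_eq (p ++ q) s].

Lemma spans1_rev_seq s x y : spans1 s x y -> spans1 (rev s) x y.
Proof. by move=> [p xp ps]; exists p => //; perm_count. Qed.

Lemma spans2_rev_seq s x y z w : spans2 s x y z w -> spans2 (rev s) x y z w.
Proof. by move=> [p [q [xp zq ps]]]; exists p, q; split=> //; perm_count. Qed.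

Lemma spans2_rev2 s x y z w : spans2 s x y z w -> spans2 s x y w z.
Proof.
move=> [p [q [xp zq ps]]]; exists p, (rev q); split=> //; first exact: walk_rev.
by perm_count.
Qed.

(** The order of [s] is that of the cycle, so growth happens at [head u s] and [last u s]; [w] is
    the second neighbour of the new vertex. *)
Inductive block u : seq T -> Prop :=
| Block1 : block u [:: u]
| BlockR s w b : block u s -> e (last u s) b -> w \in s -> w != last u s ->
    e w b -> block u (rcons s b)
| BlockL s w a : block u s -> e a (head u s) -> w \in s -> w != head u s ->
    e w a -> block u (a :: s)
| BlockLR s a b : block u s -> e a (head u s) -> e (last u s) b -> e a b ->
    block u (a :: rcons s b).

Lemma block_rev u s : block u s -> block u (rev s).
Proof.
elim=> [|{}s w b _ IH sb ws wl wb|{}s w a _ IH sa ws wl wa|{}s a b _ IH sa sb ab].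
- exact: Block1.
- rewrite rev_rcons; apply: (BlockL (w := w)) IH _ _ _ wb;
  by rewrite ?mem_rev // head_rev // e_sym.
- rewrite rev_cons; apply: (BlockR (w := w)) IH _ _ _ wa;
  by rewrite ?mem_rev // last_rev // e_sym.
- rewrite rev_cons rev_rcons; apply: BlockLR => //.
  + by rewrite head_rev e_sym.
  + by rewrite last_rev e_sym.
  by rewrite e_sym.
Qed.

Lemma block_mem u s : block u s -> u \in s.
Proof.
elim=> [|{}s w b _ IH _ _ _ _|{}s w a _ IH _ _ _ _|{}s a b _ IH _ _ _];
  by rewrite ?(mem_rcons, inE) ?IH ?orbT // mem_seq1.
Qed.

Lemma block_walk u s : block u s -> walk (head u s) (last u s) s.
Proof.
elim=> [|{}s w b us IH sb _ _ _|{}s w a us IH sa _ _ _|{}s a b us IH sa sb _].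
- exact: walk1.
- have -> : head u (rcons s b) = head u s by case: (s) us => // /block_mem.
  by rewrite last_rcons; apply: walk_rcons IH sb.
- have -> : last u (a :: s) = last u s by case: (s) us => // /block_mem.
  by apply: walk_cons IH sa.
- by rewrite last_cons last_rcons; apply: walk_cons (walk_rcons IH sb) sa.
Qed.

Lemma block_ends_neq u s : block u s -> uniq s ->
  s = [:: u] \/ head u s != u /\ last u s != u.
Proof.
elim=> [|{}s w b us IH sb ws wl wb|{}s w a us IH sa ws wl wa|{}s a b us IH sa sb ab].
- by left.
- rewrite rcons_uniq => /andP[bs /IH[sE|[hu lu]]].
    by move: ws wl; rewrite sE mem_seq1 => ->.
  right; rewrite last_rcons; split.
    by case: s us {IH sb ws wl bs} hu lu => // /block_mem.
  by apply: contraNneq bs => ->; apply: block_mem.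
- rewrite /= => /andP[as_ /IH[sE|[hu lu]]].
    by move: ws wl; rewrite sE mem_seq1 => ->.
  right; split; first by apply: contraNneq as_ => ->; apply: block_mem.
  by case: s us {IH sa ws wl as_} hu lu => // /block_mem.
- rewrite /= mem_rcons inE negb_or rcons_uniq last_rcons.
  move=> /and3P[/andP[_ as_] bs _]; right; split.
    by apply: contraNneq as_ => ->; apply: block_mem.
  by apply: contraNneq bs => ->; apply: block_mem.
Qed.

(* The fields [linked_headP] and [linked_lastP] are exactly what is needed to
   keep [linked_head] and [linked_last] when the block grows: a new vertex
   adjacent to the last vertex [b] and to [z] is inserted between them. *)
Record linked u s : Prop := Linked {
  linked_head : spans1 s u (head u s);
  linked_last : spans1 s u (last u s);
  linked_lastP z : z \in s -> z != last u s ->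
    spans2 s u (last u s) z (head u s) \/ spans2 s u z (last u s) (head u s);
  linked_headP z : z \in s -> z != head u s ->
    spans2 s u (head u s) z (last u s) \/ spans2 s u z (head u s) (last u s);
  linked_mid z : z \in s -> z != u ->
    spans2 s u (last u s) z (head u s) \/ spans2 s u (head u s) z (last u s);
  linked_heads : head u s != u -> spans2 s u (last u s) (head u s) (head u s);
  linked_lasts : last u s != u -> spans2 s u (head u s) (last u s) (last u s)
}.

Lemma linked_rev u s : linked u s -> linked u (rev s).
Proof.
case=> h1 h2 h3 h4 h5 h6 h7; split; rewrite ?head_rev ?last_rev.
- exact: spans1_rev_seq.
- exact: spans1_rev_seq.
- move=> z; rewrite mem_rev => zs zl.
  by case: (h4 z zs zl) => /spans2_rev_seq; [left|right].
- move=> z; rewrite mem_rev => zs zl.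
  by case: (h3 z zs zl) => /spans2_rev_seq; [left|right].
- move=> z; rewrite mem_rev => zs zl.
  by case: (h5 z zs zl) => /spans2_rev_seq; [right|left].
- by move=> /h7/spans2_rev_seq.
- by move=> /h6/spans2_rev_seq.
Qed.

Lemma spans2_rcons2 s x y z w b :
  spans2 s x y z w -> e w b -> spans2 (rcons s b) x y z b.
Proof.
move=> [p [q [xp zq ps]]] wb; exists p, (rcons q b).
by split=> //; [apply: walk_rcons zq wb | perm_count].
Qed.

Lemma spans2_rcons1 s x y z w b :
  spans2 s x y z w -> e y b -> spans2 (rcons s b) x b z w.
Proof.
move=> [p [q [xp zq ps]]] wb; exists (rcons p b), q.
by split=> //; [apply: walk_rcons xp wb | perm_count].
Qed.

Lemma spans2_cons2 s x y z w b :
  spans2 s x y z w -> e z b -> spans2 (rcons s b) x y b w.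
Proof. by move/spans2_rev2 => h zb; apply/spans2_rev2/(spans2_rcons2 h zb). Qed.

Lemma spans2_new s x y b : spans1 s x y -> spans2 (rcons s b) x y b b.
Proof.
by move=> [p xp ps]; exists p, [:: b]; split=> //; [apply: walk1 | perm_count].
Qed.

Lemma spans1_rcons s x y b : spans1 s x y -> e y b -> spans1 (rcons s b) x b.
Proof.
move=> [p xp ps] yb; exists (rcons p b); first exact: walk_rcons xp yb.
by perm_count.
Qed.

Lemma spans1_join s x y z w b : spans2 s x y z w -> e y b -> e z b ->
  spans1 (rcons s b) x w.
Proof.
move=> [p [q [xp zq ps]]] yb zb; exists (rcons p b ++ q); last by perm_count.
by apply: walk_cat (walk_rcons xp yb) _ zq; rewrite e_sym.
Qed.

(** The path to the head joins at [b] the two paths that [linked_lastP] gives for [w]. The other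
    fields prolong an old path to [b], or take [[:: b]] as a path of its own. *)
Lemma linked_rcons u s w b : block u s -> uniq s -> linked u s ->
  e (last u s) b -> w \in s -> w != last u s -> e w b -> linked u (rcons s b).
Proof.
move=> us uniqs [h1 h2 h3 h4 h5 h6 h7] sb ws wl wb.
have hE : head u (rcons s b) = head u s by case: (s) us => // /block_mem.
have [sE|[hu lu]] := block_ends_neq us uniqs.
  by move: ws wl; rewrite sE mem_seq1 => ->.
split; rewrite ?hE ?last_rcons.
- by case: (h3 w ws wl) => h; [|move/spans2_rev2: h => h];
    [apply: spans1_join h sb wb | apply: spans1_join (spans2_rev2 h) wb sb].
- exact: spans1_rcons h2 sb.
- move=> z; rewrite mem_rcons inE => /orP[/eqP ->|zs _]; first by rewrite eqxx.
  (* The old last vertex must stay an end of a path, so [b] is attached to [w] instead. *)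
  have [->|zl] := eqVneq z (last u s).
    case: (h3 w ws wl) => h; last by left; apply: spans2_rcons1 h wb.
    by right; apply: spans2_cons2 h wb.
  by case: (h3 z zs zl) => h; [left; apply: spans2_rcons1 h sb
                              |right; apply: spans2_cons2 h sb].
- move=> z; rewrite mem_rcons inE => /orP[/eqP -> _|zs zh].
    by left; apply: spans2_new.
  by case: (h4 z zs zh) => h; [left|right]; apply: spans2_rcons2 h sb.
- move=> z; rewrite mem_rcons inE => /orP[/eqP -> _|zs zu].
    by right; apply: spans2_new.
  by case: (h5 z zs zu) => h; [left; apply: spans2_rcons1 h sb
                              |right; apply: spans2_rcons2 h sb].
- by move=> _; apply: spans2_rcons1 (h6 hu) sb.
- by move=> _; apply: spans2_new.
Qed.

Lemma spans2_perm s t x y z w : perm_eq s t -> spans2 s x y z w -> spans2 t x y z w.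
Proof.
move=> st [p [q [xp zq ps]]]; exists p, q; split=> //.
exact: perm_trans ps st.
Qed.

Lemma spans1_perm s t x y : perm_eq s t -> spans1 s x y -> spans1 t x y.
Proof. by move=> st [p xp ps]; exists p => //; apply: perm_trans ps st. Qed.

Lemma spans2_edge s x y a b : spans1 s x y -> e a b ->
  spans2 (rcons (rcons s b) a) x y b a.
Proof.
move=> [p xp ps] ab; exists p, [:: b; a]; split=> //; last by perm_count.
by rewrite /= eqxx e_sym ab eqxx.
Qed.

(** The new vertices prolong an old system at both ends of [s], or one of them stays alone, or the
    edge [a b] is used: as a path of its own, or to end a spanning path. *)
Lemma linked_both u s a b : block u s -> linked u s -> e a (head u s) ->
  e (last u s) b -> e a b -> linked u (a :: rcons s b).
Proof.
move=> us [h1 h2 h3 h4 h5 h6 h7] sa sb ab.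
have ha : e (head u s) a by rewrite e_sym.
have ba : e b a by rewrite e_sym.
have pE : perm_eq (rcons (rcons s b) a) (a :: rcons s b).
  by rewrite perm_rcons.
have pE' : perm_eq (rcons (rcons s a) b) (a :: rcons s b) by perm_count.
have ext x y z w : spans2 s x y z w -> e y b -> e w a ->
    spans2 (a :: rcons s b) x b z a.
  move=> h yb wa; apply: spans2_perm pE _.
  by apply: spans2_rcons2 (spans2_rcons1 h yb) wa.
have ext' x y z w : spans2 s x y z w -> e y a -> e w b ->
    spans2 (a :: rcons s b) x a z b.
  move=> h yb wa; apply: spans2_perm pE' _.
  by apply: spans2_rcons2 (spans2_rcons1 h yb) wa.
have ext2 x y z w : spans2 s x y z w -> e z b -> e w a ->
    spans2 (a :: rcons s b) x y b a.
  move=> h yb wa; apply: spans2_perm pE _.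
  by apply: spans2_rcons2 (spans2_cons2 h yb) wa.
have newa : spans2 (a :: rcons s b) u b a a.
  by apply: spans2_perm pE _; apply: spans2_new; apply: spans1_rcons h2 sb.
have newb : spans2 (a :: rcons s b) u a b b.
  by apply: spans2_perm pE' _; apply: spans2_new; apply: spans1_rcons h1 ha.
split; rewrite /= ?last_rcons.
- by apply: spans1_perm pE _; apply: spans1_rcons (spans1_rcons h2 sb) ba.
- by apply: spans1_perm pE' _; apply: spans1_rcons (spans1_rcons h1 ha) ab.
- move=> z; rewrite inE mem_rcons inE => /or3P[/eqP-> _|/eqP->|zs _].
  + by left.
  + by rewrite eqxx.
  have [->|zl] := eqVneq z (last u s).
    right; apply: spans2_perm pE _; exact: spans2_edge h2 ab.
  by case: (h3 z zs zl) => h; [left; apply: ext h sb ha|right; apply: ext2 h sb ha].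
- move=> z; rewrite inE mem_rcons inE => /or3P[/eqP->|/eqP-> _|zs _].
  + by rewrite eqxx.
  + by left.
  have [->|zl] := eqVneq z (head u s).
    right; apply: spans2_perm pE' _; exact: spans2_edge h1 ba.
  case: (h4 z zs zl) => h; first by left; apply: ext' h ha sb.
  by right; apply/spans2_rev2; apply: ext2 (spans2_rev2 h) sb ha.
- move=> z; rewrite inE mem_rcons inE => /or3P[/eqP-> _|/eqP-> _|zs zu].
  + by left.
  + by right.
  by case: (h5 z zs zu) => h; [left; apply: ext h sb ha|right; apply: ext' h ha sb].
- by [].
- by [].
Qed.

Lemma block_linked u s : block u s -> uniq s -> linked u s.
Proof.
elim=> [_|{}s w b us IH sb ws wl wb|{}s w a us IH sa ws wl wa|{}s a b us IH sa sb ab].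
- have h1 : spans1 [:: u] u u by exists [:: u]; [apply: walk1 | ].
  by split=> //=; rewrite ?eqxx // => z; rewrite mem_seq1 => ->.
- rewrite rcons_uniq => /andP[_ uniqs]; exact: linked_rcons us uniqs (IH uniqs) sb ws wl wb.
- rewrite /= => /andP[_ uniqs]; rewrite -[a :: s]revK rev_cons.
  apply: linked_rev; apply: (linked_rcons (w := w)) (linked_rev (IH uniqs)) _ _ _ wa.
  + exact: block_rev.
  + by rewrite rev_uniq.
  + by rewrite last_rev e_sym.
  + by rewrite mem_rev.
  by rewrite last_rev.
- rewrite /= rcons_uniq => /and3P[_ _ uniqs].
  exact: linked_both us (IH uniqs) sa sb ab.
Qed.

End Blocks.

(** * Short-cuts between two blocks on a longest cycle with a bridge *)

Section Frames.
Variables (T : eqType) (e : rel T) (m : nat).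
Hypothesis e_sym : symmetric e.
Hypothesis cycle_bound : forall c, cycle e c -> uniq c -> size c <= m.
Implicit Types (u v w x y z a b : T) (p q s t D X Y P : seq T).

Lemma no_long_cycle x y p L s : walk e x y p -> link e y L x ->
  perm_eq (p ++ L) s -> uniq s -> m < size s -> False.
Proof.
move=> xp yL ps us; have := cycle_bound (cycle_walk xp yL).
rewrite (perm_uniq ps) (perm_size ps) => /(_ us); lia.
Qed.

(** The cycle reads [Du], [X], [Dv], [Y] in cyclic order and has the greatest length [m] allowed by
    [cycle_bound]; [P] is the inner part of the bridge. *)
Record frame u v Du X Dv Y P : Prop := Frame {
  frame_blockl : block e u Du;
  frame_blockr : block e v Dv;
  frame_linkX : link e (last u Du) X (head v Dv);
  frame_linkY : link e (last v Dv) Y (head u Du);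
  frame_linkP : link e u P v;
  frame_uniq : uniq (Du ++ X ++ Dv ++ Y ++ P);
  frame_size : size (Du ++ X ++ Dv ++ Y) = m;
  frame_bridge : 0 < size P }.

(** Exchanging the ends of the bridge and, in [frame_mirror], reversing the cycle are the symmetries
    that let an argument be made at one block and in one direction. *)
Lemma frame_swap u v Du X Dv Y P :
  frame u v Du X Dv Y P -> frame v u Dv Y Du X (rev P).
Proof.
case=> bu bv lX lY lP uq sz P0; split=> //; last by rewrite size_rev.
- exact: link_rev.
- rewrite (perm_uniq (_ : perm_eq _ (Du ++ X ++ Dv ++ Y ++ P))) //; perm_count.
- rewrite -sz !size_cat; lia.
Qed.

Lemma frame_mirror u v Du X Dv Y P : frame u v Du X Dv Y P ->
  frame u v (rev Du) (rev Y) (rev Dv) (rev X) P.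
Proof.
case=> bu bv lX lY lP uq sz P0; split=> //; rewrite ?last_rev ?head_rev.
- exact: block_rev.
- exact: block_rev.
- exact: link_rev.
- exact: link_rev.
- rewrite (perm_uniq (_ : perm_eq _ (Du ++ X ++ Dv ++ Y ++ P))) //; perm_count.
- rewrite -sz !size_cat !size_rev; lia.
Qed.

Lemma frame_uniql u v Du X Dv Y P : frame u v Du X Dv Y P -> uniq Du.
Proof. by case=> _ _ _ _ _; rewrite cat_uniq => /and3P[]. Qed.

Lemma frame_uniqr u v Du X Dv Y P : frame u v Du X Dv Y P -> uniq Dv.
Proof. by move/frame_swap/frame_uniql. Qed.

Lemma frame_linkedl u v Du X Dv Y P : frame u v Du X Dv Y P -> linked e u Du.
Proof. by move=> fr; apply: block_linked (frame_blockl fr) (frame_uniql fr). Qed.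

Lemma frame_linkedr u v Du X Dv Y P : frame u v Du X Dv Y P -> linked e v Dv.
Proof. by move/frame_swap/frame_linkedl. Qed.

(** If [X] were empty, one could go through [Du] from [u] to its head, back along [Y], through [Dv]
    from its last vertex to [v], and home along [P], gaining all of [P]. *)
Lemma frame_gapX u v Du X Dv Y P : frame u v Du X Dv Y P -> X <> [::].
Proof.
move=> fr XE; have [p up pD] := linked_head (frame_linkedl fr).
have [q vq qD] := linked_last (frame_linkedr fr).
case: fr => bu bv lX lY lP uq sz P0.
apply: (no_long_cycle (walk_link up (link_rev e_sym lY) (walk_rev e_sym vq))
         (link_rev e_sym lP) _ uq); last by move: sz; rewrite XE !size_cat; clear -P0; lia.
by rewrite XE; perm_count.
Qed.

Lemma frame_gapY u v Du X Dv Y P : frame u v Du X Dv Y P -> Y <> [::].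
Proof. by move/frame_swap/frame_gapX. Qed.

(** Otherwise [linked_lastP] splits [Du] so that the edge [x y], both gaps and [P] close up to a
    cycle through every vertex of the frame. *)
Lemma frame_cross_last u v Du X Dv Y P x y : frame u v Du X Dv Y P ->
  spans2 e Dv v (last v Dv) y (head v Dv) -> x \in Du -> e x y -> x = last u Du.
Proof.
move=> fr [q [r [vq yr qrD]]] xD xy; apply/eqP; apply: contraT => xl; exfalso.
have [] := linked_lastP (frame_linkedl fr) xD xl => -[p [t [up xt ptD]]];
  case: fr => bu bv lX lY lP uq sz P0.
  (* Route: [u] to the last of [Du], [X], head of [Dv] to [y], [x] to the head of [Du], [Y]
     backwards, last of [Dv] to [v], [P] backwards. *)
  have yx : e y x by rewrite e_sym.
  have h1 := walk_link up lX (walk_rev e_sym yr).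
  have h2 := walk_link (walk_cat h1 yx xt) (link_rev e_sym lY) (walk_rev e_sym vq).
  apply: (no_long_cycle h2 (link_rev e_sym lP) _ uq).
    by perm_count.
  by move: sz; rewrite !size_cat; clear -P0; lia.
(* Route: [u] to [x], [y] to the head of [Dv], [X] backwards, last to head of [Du], then as
   before. *)
have h1 := walk_link (walk_cat up xy yr) (link_rev e_sym lX) xt.
have h2 := walk_link h1 (link_rev e_sym lY) (walk_rev e_sym vq).
apply: (no_long_cycle h2 (link_rev e_sym lP) _ uq).
  by perm_count.
by move: sz; rewrite !size_cat; clear -P0; lia.
Qed.

Lemma frame_cross_head u v Du X Dv Y P x y : frame u v Du X Dv Y P ->
  spans2 e Dv v (head v Dv) y (last v Dv) -> x \in Du -> e x y -> x = head u Du.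
Proof.
move/frame_mirror => fr /spans2_rev_seq h xD xy.
rewrite -last_rev; apply: (frame_cross_last fr _ _ xy); last by rewrite mem_rev.
by rewrite last_rev head_rev.
Qed.

Lemma frame_cross_end u v Du X Dv Y P x y : frame u v Du X Dv Y P ->
  x \in Du -> y \in Dv -> y != v -> e x y -> x = head u Du \/ x = last u Du.
Proof.
move=> fr xD yD yv xy; have [h|h] := linked_mid (frame_linkedr fr) yD yv.
  by right; apply: frame_cross_last fr h xD xy.
by left; apply: frame_cross_head fr h xD xy.
Qed.

(** Applied from both sides, [frame_cross_end] leaves only [u v] and pairs of ends; the one-vertex
    paths of [linked_heads] and [linked_lasts] then exclude head to head and last to last. *)
Lemma frame_cross u v Du X Dv Y P x y : frame u v Du X Dv Y P ->
  1 < size Du -> 1 < size Dv -> x \in Du -> y \in Dv -> e x y ->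
  [\/ x = u /\ y = v, x = head u Du /\ y = last v Dv
    | x = last u Du /\ y = head v Dv].
Proof.
move=> fr szu szv xD yD xy; have fr' := frame_swap fr.
have yx : e y x by rewrite e_sym.
have [DE|[hu lu]] := block_ends_neq (frame_blockl fr) (frame_uniql fr).
  by move: szu; rewrite DE.
have [DE|[hv lv]] := block_ends_neq (frame_blockr fr) (frame_uniqr fr).
  by move: szv; rewrite DE.
have [yE|yv] := eqVneq y v.
  have [xE|xu] := eqVneq x u; first by constructor 1.
  by move: hv lv; case: (frame_cross_end fr' yD xD xu yx) => <-; rewrite yE eqxx.
have xu : x != u.
  by case: (frame_cross_end fr xD yD yv xy) => ->.
case: (frame_cross_end fr' yD xD xu yx) => yE.
  constructor 3; split=> //; apply: (frame_cross_last fr _ xD xy).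
  by rewrite yE; apply: linked_heads (frame_linkedr fr) hv.
constructor 2; split=> //; apply: (frame_cross_head fr _ xD xy).
by rewrite yE; apply: linked_lasts (frame_linkedr fr) lv.
Qed.

Lemma uniq_ends x s : uniq s -> 1 < size s -> head x s != last x s.
Proof.
case: s => [|y [|z s]] //= /andP[ys _] _; apply: contraNneq ys => ->.
exact: mem_last.
Qed.

(* The cross edges of [frame_cross] form a matching. *)
Lemma frame_cross_rect u v Du X Dv Y P x x' y y' : frame u v Du X Dv Y P ->
  x \in Du -> x' \in Du -> y \in Dv -> y' \in Dv -> x != x' -> y != y' ->
  e x y || e x' y' -> e x y' || e x' y -> False.
Proof.
move=> fr xD xD' yD yD' xx yy.
have szu : 1 < size Du.
  by case: Du {fr} xD xD' => [|a [|b D]] //; rewrite !mem_seq1 => /eqP<-; rewrite eq_sym (negPf xx).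
have szv : 1 < size Dv.
  by case: Dv {fr} yD yD' => [|a [|b D]] //; rewrite !mem_seq1 => /eqP<-; rewrite eq_sym (negPf yy).
have [DE|[hu lu]] := block_ends_neq (frame_blockl fr) (frame_uniql fr).
  by move: szu; rewrite DE.
have [DE|[hv lv]] := block_ends_neq (frame_blockr fr) (frame_uniqr fr).
  by move: szv; rewrite DE.
have hlu := uniq_ends u (frame_uniql fr) szu.
have hlv := uniq_ends v (frame_uniqr fr) szv.
have cr := @frame_cross _ _ _ _ _ _ _ _ _ fr szu szv.
have key x1 y1 y2 : x1 \in Du -> y1 \in Dv -> y2 \in Dv -> e x1 y1 -> e x1 y2 ->
    y1 = y2.
  move=> xD1 yD1 yD2 /(cr _ _ xD1 yD1)[] [xE ->] /(cr _ _ xD1 yD2)[] [xE' ->] //.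
  - by rewrite -xE' xE eqxx in hu.
  - by rewrite -xE' xE eqxx in lu.
  - by rewrite -xE xE' eqxx in hu.
  - by rewrite -xE -xE' eqxx in hlu.
  - by rewrite -xE xE' eqxx in lu.
  - by rewrite -xE -xE' eqxx in hlu.
have key' x1 x2 y1 : x1 \in Du -> x2 \in Du -> y1 \in Dv -> e x1 y1 -> e x2 y1 ->
    x1 = x2.
  move=> xD1 xD2 yD1 /(cr _ _ xD1 yD1)[] [-> yE] /(cr _ _ xD2 yD1)[] [-> yE'] //.
  - by rewrite -yE' yE eqxx in lv.
  - by rewrite -yE' yE eqxx in hv.
  - by rewrite -yE yE' eqxx in lv.
  - by rewrite -yE -yE' eqxx in hlv.
  - by rewrite -yE yE' eqxx in hv.
  - by rewrite -yE -yE' eqxx in hlv.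
move=> /orP[] h1 /orP[] h2.
- by rewrite (key _ _ _ xD yD yD' h1 h2) eqxx in yy.
- by rewrite (key' _ _ _ xD xD' yD h1 h2) eqxx in xx.
- by rewrite (key' _ _ _ xD xD' yD' h2 h1) eqxx in xx.
- by rewrite (key _ _ _ xD' yD yD' h2 h1) eqxx in yy.
Qed.

(** Otherwise the cycle gains [z]: from [u] to one end of [Du], around to the other end, on to [x],
    then [z] and back to [u]. *)
Lemma frame_bridge_block u v Du X Dv Y P x z : frame u v Du X Dv Y P ->
  z \in P -> e u z -> x \in Du -> e z x -> x = u.
Proof.
(* The splitting given by [linked_mid] fits either the frame itself or its mirror image. *)
wlog h : Du X Dv Y / x != u -> spans2 e Du u (last u Du) x (head u Du).
  move=> wl fr zP uz xD zx; have [//|xu] := eqVneq x u.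
  have [h|h] := linked_mid (frame_linkedl fr) xD xu.
    by apply: (wl Du X Dv Y).
  apply: (wl _ _ _ _ _ (frame_mirror fr)) => //; last by rewrite mem_rev.
  by move=> _; rewrite last_rev head_rev; apply: spans2_rev_seq.
move=> fr zP uz xD zx; apply/eqP; apply: contraT => xu; exfalso.
have [p [q [up xq pqD]]] := h xu.
case: fr => bu bv lX lY lP uq sz P0.
have lL : link e (last u Du) (X ++ Dv ++ Y) (head u Du).
  exact: link_cat lX (block_walk bv) lY.
have xz : e x z by rewrite e_sym.
have zu : e z u by rewrite e_sym.
have h1 := walk_rcons (walk_link up lL (walk_rev e_sym xq)) xz.
have l0 : link e z [::] u by rewrite /link /= zu.
have zN : uniq (z :: Du ++ X ++ Dv ++ Y).
  move: uq; rewrite !catA cat_uniq => /and3P[uq /hasPn /(_ z zP) zN _].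
  by rewrite /= -!catA in uq zN *; rewrite zN.
apply: (no_long_cycle h1 l0 _ zN); first by perm_count.
by rewrite /= sz.
Qed.

(** A spanning path of [Du] from [u] to its last vertex opens the cycle between [a] and [u], where
    [z] can be inserted. *)
Lemma frame_bridge_gapY u v Du X Dv Y P a z : frame u v Du X Dv (rcons Y a) P ->
  z \in P -> e u z -> e z a -> False.
Proof.
move=> fr zP uz za; have [p up pD] := linked_last (frame_linkedl fr).
case: fr => bu bv lX lY lP uq sz P0.
have lY' : link e (last v Dv) Y a by move: lY; rewrite /link rcons_path => /andP[].
have zu : e z u by rewrite e_sym.
have h1 := walk_link up (link_cat lX (block_walk bv) lY') (walk_rcons (walk1 e a) (_ : e a z)).
have l0 : link e z [::] u by rewrite /link /= zu.
have zN : uniq (z :: Du ++ X ++ Dv ++ rcons Y a).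
  move: uq; rewrite !catA cat_uniq => /and3P[uq /hasPn /(_ z zP) zN _].
  by rewrite /= -!catA in uq zN *; rewrite zN.
apply: (no_long_cycle (h1 _) l0 _ zN); [by rewrite e_sym|by perm_count|].
by rewrite /= sz.
Qed.

Lemma frame_bridge_gapX u v Du b X Dv Y P z : frame u v Du (b :: X) Dv Y P ->
  z \in P -> e u z -> e z b -> False.
Proof. by move/frame_mirror; rewrite rev_cons; apply: frame_bridge_gapY. Qed.

Lemma frame_growX u v Du b X Dv Y P w : frame u v Du (b :: X) Dv Y P ->
  w \in Du -> w != last u Du -> e w b -> frame u v (rcons Du b) X Dv Y P.
Proof.
case=> bu bv lX lY lP uq sz P0 wD wl wb; move: lX; rewrite /link /= => /andP[lb lX].
split=> //.
- exact: BlockR bu lb wD wl wb.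
- by rewrite last_rcons.
- by have -> : head u (rcons Du b) = head u Du by case: (Du) bu => // /block_mem.
- by rewrite cat_rcons.
- by rewrite cat_rcons.
Qed.

Lemma frame_growY u v Du X Dv Y a P w : frame u v Du X Dv (rcons Y a) P ->
  w \in Du -> w != head u Du -> e w a -> frame u v (a :: Du) X Dv Y P.
Proof.
move=> fr wD wh wa; have := frame_mirror fr; rewrite rev_rcons => fr'.
have := frame_growX fr' (_ : w \in rev Du); rewrite mem_rev last_rev => /(_ wD wh wa).
by move/frame_mirror; rewrite rev_rcons !revK.
Qed.

Lemma frame_growXY u v Du b X Dv Y a P : frame u v Du (b :: X) Dv (rcons Y a) P ->
  e a b -> frame u v (a :: rcons Du b) X Dv Y P.
Proof.
case=> bu bv lX lY lP uq sz P0 ab; move: lX; rewrite /link /= => /andP[lb lX].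
move: lY; rewrite /link rcons_path last_rcons => /andP[lY la].
split=> //.
- exact: BlockLR.
- by rewrite /= last_rcons.
- rewrite (perm_uniq (_ : perm_eq _ (Du ++ (b :: X) ++ Dv ++ rcons Y a ++ P))) //.
  by perm_count.
- move: sz; rewrite /= !size_cat /= !(size_cat, size_rcons); clear; lia.
Qed.

End Frames.

(** * Heavy adjacency and the Bondy-Chvatal exchange *)

Section HeavyAdjacency.
Variable G : sgraph.
Implicit Types (x y z : G) (p q c : seq G).
Local Notation n := #|G|.

(** The disequality is imposed because a vertex of degree at least [n / 2] would otherwise be
    heavily adjacent to itself. *)
Definition hadj : rel G := fun x y => (x != y) && (adj x y || (n <= degree x + degree y)).

Lemma hadj_sym : symmetric hadj.
Proof. by move=> x y; rewrite /hadj eq_sym adj_sym addnC. Qed.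

Lemma adj_neq x y : adj x y -> x != y.
Proof. by apply: contraTneq => ->; rewrite adj_irr. Qed.

Lemma adj_hadj x y : adj x y -> hadj x y.
Proof. by move=> xy; rewrite /hadj xy (adj_neq xy). Qed.

Fixpoint nonadj_steps x p :=
  if p is y :: p' then ~~ adj x y + nonadj_steps y p' else 0.

Lemma nonadj_steps_cat x p q :
  nonadj_steps x (p ++ q) = nonadj_steps x p + nonadj_steps (last x p) q.
Proof. by elim: p x => //= y p IH x; rewrite IH addnA. Qed.

Lemma nonadj_steps_rcons x p y :
  nonadj_steps x (rcons p y) = nonadj_steps x p + ~~ adj (last x p) y.
Proof. by rewrite -cats1 nonadj_steps_cat /= addn0. Qed.

Lemma nonadj_steps_rev x p :
  nonadj_steps (last x p) (rev (belast x p)) = nonadj_steps x p.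
Proof.
elim: p x => //= y p IH x; rewrite rev_cons nonadj_steps_rcons IH addnC.
have -> : last (last y p) (rev (belast y p)) = y.
  by case: p {IH} => //= z p; rewrite rev_cons last_rcons.
by rewrite adj_sym.
Qed.

Lemma nonadj_steps_size x p : nonadj_steps x p <= size p.
Proof. by elim: p x => //= y p IH x; move: (IH y); case: adj => /=; lia. Qed.

Lemma nonadj_steps_path x p :
  path (@adj G) x p \/ exists p1 y p2, p = p1 ++ y :: p2 /\ ~~ adj (last x p1) y.
Proof.
elim: p x => [|y p IH] x /=; first by left.
have [xy|xy] := boolP (adj x y); last by right; exists [::], y, p.
case: (IH y) => [->|[p1 [z [p2 [-> h]]]]]; first by left.
by right; exists (y :: p1), z, p2.
Qed.

(** Ore's counting: without crossing chords, each step of the walk contributes at most one to the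
    two counts together. *)
Lemma crossing_or_count x y z q :
  (exists q1 w q2, [/\ q = q1 ++ w :: q2, adj y w & adj z (last x q1)]) \/
  count (adj y) q + count (adj z) (belast x q) <= size q.
Proof.
elim: q x => [|w q IH] x /=; first by right.
have [/andP[yw zx]|h] := boolP (adj y w && adj z x).
  by left; exists [::], w, q.
case: (IH w) => [[q1 [w' [q2 [-> yw' zl]]]]|le]; first by left; exists (w :: q1), w', q2.
by right; move: h le; case: adj; case: adj => //= _; lia.
Qed.

Lemma card_adj_seq x q : uniq q ->
  #|[set y | adj x y] :&: [set y in q]| = count (adj x) q.
Proof.
move=> uq; rewrite -size_filter -(card_uniqP (filter_uniq _ uq)).
by apply: eq_card => y; rewrite !inE mem_filter.
Qed.

(** Outside [q] the two neighbourhoods are disjoint, so together they have at most [n - size q]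
    vertices there. *)
Lemma degree_seq_le x y q : uniq q ->
  (forall z, adj x z -> adj y z -> z \in q) ->
  degree x + degree y + size q <= n + count (adj x) q + count (adj y) q.
Proof.
move=> uq common; rewrite /degree.
rewrite -(cardsID [set z in q] [set z | adj x z]) -(cardsID [set z in q] [set z | adj y z]).
rewrite !card_adj_seq //.
set A := _ :\: _; set B := _ :\: [set z in q].
have sq : size q = #|[set z in q]|.
  by rewrite -(card_uniqP uq); apply: eq_card => z; rewrite inE.
have : #|A| + #|B| + size q <= n.
  have dAB : A :&: B = set0.
    apply/setP=> z; rewrite !inE; apply/negP=> /andP[/andP[zq xz] /andP[_ yz]].
    by rewrite (common z xz yz) in zq.
  rewrite -(cardsUI A B) dAB cards0 addn0 sq -(cardsC [set z in q]) addnC leq_add2l.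
  by apply/subset_leq_card/subsetP => z; rewrite !inE => /orP[]/andP[].
lia.
Qed.

(** Brings a step that is not an edge to the closing position, where the exchange acts. *)
Lemma rotate_to_nonadj x p : path hadj x (rcons p x) -> uniq (x :: p) ->
  path (@adj G) x (rcons p x) \/
  exists y q, [/\ path hadj y (rcons q y), uniq (y :: q), size q = size p,
    ~~ adj (last y q) y &
    nonadj_steps y (rcons q y) = nonadj_steps x (rcons p x)].
Proof.
move=> xp up; have [h|[p1 [y [p2]]]] := nonadj_steps_path x (rcons p x); first by left.
case/lastP: p2 => [|p2 z] [E h]; right.
  move/eqP: E; rewrite cats1 eqseq_rcons => /andP[/eqP E /eqP ?]; subst.
  by exists y, p1.
move/eqP: E; rewrite -rcons_cons -rcons_cat eqseq_rcons => /andP[/eqP ? /eqP ?]; subst.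
exists y, (p2 ++ z :: p1); split.
- move: xp; rewrite !rcons_cat !cat_path /= => /and3P[zp1 ly].
  by rewrite !rcons_path zp1 ly => /andP[-> ->].
- by rewrite -(perm_uniq (_ : perm_eq (z :: p1 ++ y :: p2) _)) //; perm_count.
- by rewrite !size_cat /= !addnS addnC.
- by rewrite last_cat.
- rewrite !rcons_cat !nonadj_steps_cat /= !nonadj_steps_rcons; lia.
Qed.

(* Bondy-Chvatal: a closing pair [y, z] of degree sum at least [n] either has a
   common neighbour off the cycle, or two crossing chords replace it. *)
Lemma adj_cycle_of_hadj_cycle c : cycle hadj c -> uniq c ->
  exists c', [/\ cycle (@adj G) c', uniq c' & size c <= size c'].
Proof.
case: c => [|x p] /=; first by exists [::].
(* The factor [n.+2] exceeds the number of steps of any cycle, so the order is lexicographic: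
   greater length first, then fewer steps that are not edges. *)
have [N] := ubnP ((n - (size p).+1) * n.+2 + nonadj_steps x (rcons p x)).
elim: N x p => // N IH x p; rewrite ltnS => leN xp up.
have [h|[y [q [yq uq szq nly stE]]]] := rotate_to_nonadj xp up.
  by exists (x :: p).
rewrite -szq -stE in leN *; move: {x p xp up szq stE} leN => leN.
have := yq; rewrite rcons_path => /andP[yq' /andP[_ /orP[ly|deg]]].
  by rewrite ly in nly.
have leq_size (r : seq G) : uniq r -> size r <= n by move/card_uniqP=> <-; apply: max_card.
have [/existsP[z /and3P[zN yz lz]]|noz] :=
  boolP [exists z, [&& z \notin y :: q, adj y z & adj (last y q) z]].
  have uzq : uniq (z :: y :: q) by rewrite cons_uniq zN.
  have [||c' [h1 h2 h3]] := IH z (y :: q) _ _ uzq; last first.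
  - by exists c'; split=> //; apply: leq_trans h3 => /=.
  - rewrite /= -/(rcons _ _) rcons_path yq' adj_hadj ?[adj z y]adj_sym //=.
    exact: adj_hadj.
  apply: leq_trans leN; have := nonadj_steps_size z (rcons (y :: q) z).
  rewrite size_rcons /=; have := leq_size _ uzq; rewrite /=; nia.
have common z : adj y z -> adj (last y q) z -> z \in y :: q.
  move=> yz lz; apply: contraT => zN; case/negP: noz.
  by apply/existsP; exists z; rewrite zN yz lz.
have := degree_seq_le uq common.
(* The last vertex is not its own neighbour; splitting it off leaves the count over [belast] that
   [crossing_or_count] bounds. *)
rewrite {3}lastI -cats1 count_cat /= adj_irr addn0 !adj_irr add0n.
have [[q1 [w [q2 [qE yw lw]]]]|] := crossing_or_count y y (last y q) q; last first.
  move=> h1; rewrite /= addn0 => h2; exfalso; move: h1 h2 deg.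
  move: (degree y) (degree _) (count _ _) (count _ _) (size q) #|G| => *; lia.
move=> _; rewrite qE last_cat /= in yq' nly lw leN uq *.
have revE : rev (w :: q2) = last w q2 :: rev (belast w q2) by rewrite lastI rev_rcons.
have lr : last y (q1 ++ rev (w :: q2)) = w by rewrite last_cat rev_cons last_rcons.
have pu : perm_eq (y :: q1 ++ rev (w :: q2)) (y :: q1 ++ w :: q2) by perm_count.
(* The reversed tail is entered by one chord and left for [y] by the other, so the closing step that
   was not an edge disappears. *)
have [||| c' [h1 h2 h3]] := IH y (q1 ++ rev (w :: q2)).
- apply: leq_trans leN; rewrite !nonadj_steps_rcons lr last_cat /= -[adj w y]adj_sym yw.
  rewrite !nonadj_steps_cat revE /= nonadj_steps_rev adj_sym lw nly !size_cat /= size_rev.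
  by rewrite size_belast ltn_add2l; case: (adj _ w) => /=; lia.
- move: yq'; rewrite rcons_path lr adj_hadj ?[adj w y]adj_sym // andbT.
  rewrite !cat_path /= => /and3P[-> _ wq2]; rewrite revE /= adj_hadj; last by rewrite adj_sym.
  by rewrite rev_path (eq_path (e' := hadj)) // => a b; rewrite hadj_sym.
- by rewrite -cons_uniq (perm_uniq pu).
exists c'; split=> //; move: h3; rewrite !size_cat size_rev; lia.
Qed.
End HeavyAdjacency.

(** * Embedded copies of a graph, and first and last hits in sequences *)

Lemma embed_isomorphic (G H : sgraph) (g : H -> G) :
  injective g -> (forall i j, adj (g i) (g j) = adj i j) ->
  isomorphic (induced [set x in codom g]) H.
Proof.
move=> g_inj g_adj.
have im (x : {x : G | x \in [set x in codom g]}) : val x \in codom g.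
  by case: x => x /= h; rewrite inE in h.
have mem i : g i \in [set x in codom g] by rewrite inE codom_f.
exists (fun x => iinv (im x)).
  exists (fun i => exist _ (g i) (mem i)) => [x|i].
    by apply: val_inj; rewrite /= f_iinv.
  by apply: g_inj; rewrite f_iinv.
by move=> x y; rewrite -g_adj !f_iinv.
Qed.

Definition heavy_pair (G : sgraph) (x y : G) :=
  [&& x != y, ~~ adj x y & #|G| <= degree x + degree y].

Lemma embed_heavy (G H : sgraph) (g : H -> G) : is_heavy G H ->
  injective g -> (forall i j, adj (g i) (g j) = adj i j) ->
  exists i j, heavy_pair (g i) (g j).
Proof.
move=> hH g_inj g_adj; have [x [y []]] := hH _ (embed_isomorphic g_inj g_adj).
rewrite !inE => /codomP[i ->] /codomP[j ->] xy nxy d.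
by exists i, j; rewrite /heavy_pair xy nxy d.
Qed.

Lemma split_first (T : Type) (P : pred T) s : has P s ->
  exists s1 x s2, [/\ s = s1 ++ x :: s2, P x & ~~ has P s1].
Proof.
elim: s => //= y s IH; have [Py _|nPy /= /IH] := boolP (P y); first by exists [::], y, s.
by move=> [s1 [x [s2 [-> Px h]]]]; exists (y :: s1), x, s2; rewrite /= negb_or nPy.
Qed.

Lemma split_last (T : Type) (P : pred T) s : has P s ->
  exists s1 x s2, [/\ s = s1 ++ x :: s2, P x & ~~ has P s2].
Proof.
rewrite -has_rev => /split_first[s1 [x [s2 [E Px h]]]].
exists (rev s2), x, (rev s1); rewrite has_rev Px h; split=> //.
by rewrite -[s]revK E rev_cat rev_cons cat_rcons.
Qed.

Lemma path_first_hit (T : eqType) (e : rel T) (P : pred T) x p :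
  path e x p -> ~~ P x -> P (last x p) ->
  exists y z, [/\ y \in x :: p, z \in p, e y z, ~~ P y & P z].
Proof.
elim: p x => [|y p IH] x /=; first by move=> _ /negPf ->.
case/andP=> xy yp nPx Pl; have [Py|nPy] := boolP (P y).
  by exists x, y; rewrite !mem_head.
have [a [b [ay bp ab nPa Pb]]] := IH y yp nPy Pl.
by exists a, b; split=> //; rewrite in_cons ?ay ?bp orbT.
Qed.

(** * Claws and nets forced by three pendant vertices *)

Section Pendants.
Variable G : sgraph.
Hypothesis claw_heavy : is_heavy G claw.
Hypothesis net_heavy : is_heavy G net.
Implicit Types (x y z t c : G) (p q s L : seq G).

Definition has_heavy_pair s := exists x y, [/\ x \in s, y \in s & heavy_pair x y].

Lemma claw_heavy_pair c x y z : adj c x -> adj c y -> adj c z ->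
  x != y -> x != z -> y != z -> ~~ adj x y -> ~~ adj x z -> ~~ adj y z ->
  has_heavy_pair [:: c; x; y; z].
Proof.
move=> cx cy cz xy xz yz nxy nxz nyz.
pose g (i : claw) := match i with inl _ => c | inr j => nth c [:: x; y; z] j end.
have nyx : ~~ adj y x by rewrite adj_sym.
have nzx : ~~ adj z x by rewrite adj_sym.
have nzy : ~~ adj z y by rewrite adj_sym.
have g_adj i j : adj (g i) (g j) = adj i j.
  by case: i j => [a|[[|[|[|?]]] ?]] [a'|[[|[|[|?]]] ?]] //=;
    rewrite ?adj_irr ?(adj_sym _ c) ?cx ?cy ?cz //; apply/negbTE.
have g_inj : injective g.
  move=> i j E; have := g_adj i j; rewrite -E adj_irr => h.
  by case: i j E h => [[[|?] ?]|[[|[|[|?]]] ?]] [[[|?] ?]|[[|[|[|?]]] ?]] //= E _;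
    try (by first [congr (inl _); apply: val_inj | congr (inr _); apply: val_inj]);
    move: xy xz yz; rewrite E eqxx.
have [i [j h]] := embed_heavy claw_heavy g_inj g_adj.
have mem k : g k \in [:: c; x; y; z].
  by case: k => [a|[[|[|[|]]]]] //= *; rewrite !inE eqxx ?orbT.
by exists (g i), (g j).
Qed.

Lemma net_heavy_pair x y z x' y' z' : adj x y -> adj x z -> adj y z ->
  adj x x' -> adj y y' -> adj z z' ->
  ~~ adj x y' -> ~~ adj x z' -> ~~ adj y x' -> ~~ adj y z' -> ~~ adj z x' ->
  ~~ adj z y' -> ~~ adj x' y' -> ~~ adj x' z' -> ~~ adj y' z' ->
  has_heavy_pair [:: x; y; z; x'; y'; z'].
Proof.
move=> xy xz yz xx yy zz h1 h2 h3 h4 h5 h6 h7 h8 h9.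
pose g (i : net) := nth x (if i.2 then [:: x'; y'; z'] else [:: x; y; z]) i.1.
have g_adj i j : adj (g i) (g j) = adj i j.
  wlog le : i j / i.1 <= j.1.
    by move=> wl; case: (leqP i.1 j.1) => [|/ltnW] /wl // h; rewrite adj_sym h adj_sym.
  by case: i j le => [[[|[|[|?]]] ?] []] [[[|[|[|?]]] ?] []] //= _;
    rewrite /g /= ?adj_irr //; first [assumption | apply/negbTE; assumption
      | rewrite adj_sym; first [assumption | apply/negbTE; assumption]].
have g_inj : injective g.
  (* Distinct vertices of the net have distinct neighbourhoods, and the five vertices tested below
     tell all six apart. *)
  move=> i j E; have nb k : adj i k = adj j k by rewrite -!g_adj E.
  move: (nb (inord 0, true)) (nb (inord 1, true)) (nb (inord 2, true)).
  move: (nb (inord 0, false)) (nb (inord 1, false)).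
  by case: i j {nb E} => [[[|[|[|?]]] ?] []] [[[|[|[|?]]] ?] []] //=;
    rewrite /net_adj /= -!val_eqE /= !inordK //= => *; congr (_, _); apply: val_inj.
have [i [j h]] := embed_heavy net_heavy g_inj g_adj.
have mem k : g k \in [:: x; y; z; x'; y'; z'].
  by case: k => [[[|[|[|?]]] ?] []] //=; rewrite /g !inE eqxx ?orbT.
by exists (g i), (g j).
Qed.

Fixpoint induced_path x p :=
  if p is y :: p' then [&& adj x y, all (fun z => ~~ adj x z) p' & induced_path y p']
  else true.

Lemma induced_path_split x p y q : induced_path x (p ++ y :: q) ->
  [/\ adj (last x p) y, all (fun z => ~~ adj (last x p) z) q & induced_path y q].
Proof. by elim: p x => [|z p IH] x /= /and3P[// _ _]; apply: IH. Qed.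

Lemma induced_path_nbr x p y : induced_path x p -> 0 < size p ->
  y \in x :: p -> has (adj y) (x :: p).
Proof.
elim: p x => // z p IH x /= /and3P[xz _ zp] _; rewrite in_cons => /predU1P[->|yp].
  by rewrite xz orbT.
case: p IH zp yp => [|w p] IH zp yp.
  by move: yp; rewrite mem_seq1 => /eqP ->; rewrite adj_sym xz.
by have /= -> := IH z zp isT yp; rewrite orbT.
Qed.

(** The tail is made induced first; then [x] jumps to its last neighbour there. *)
Lemma exists_induced_path x p : path (@adj G) x p -> uniq (x :: p) ->
  exists q, [/\ induced_path x q, last x q = last x p, uniq (x :: q) & {subset q <= p}].
Proof.
elim: p x => [|y p IH] x /=; first by exists [::].
case/andP=> xy yp /andP[xN uyp].
have [q [yq lq uq sub]] := IH y yp uyp.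
have sub' : {subset y :: q <= y :: p}.
  by move=> z; rewrite !inE => /orP[->//|/sub ->]; rewrite orbT.
have : has (adj x) (y :: q) by rewrite /= xy.
case/split_last => q1 [w [q2 [E xw nq2]]].
have ws : {subset w :: q2 <= y :: q} by move=> z zq; rewrite E mem_cat zq orbT.
exists (w :: q2); split.
- rewrite -all_predC in nq2; apply/and3P; split=> //.
  case: q1 E => [|y' q1] [yE qE]; first by rewrite -yE -qE.
  by rewrite qE in yq; case: (induced_path_split yq).
- by rewrite -lq -(last_cons x y) E last_cat.
- have uq' : uniq (w :: q2) by move: uq; rewrite E cat_uniq => /and3P[].
  by apply/andP; split=> //; apply: contra xN => /ws; apply: sub'.
- by move=> z /ws; apply: sub'.
Qed.

Lemma has_heavy_pair_sub s s' : has_heavy_pair s -> {subset s <= s'} ->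
  has_heavy_pair s'.
Proof. by move=> [x [y [xs ys h]]] sub; exists x, y; split=> //; apply: sub. Qed.

(** Let [c] be the first neighbour of [t] on the path, [b] and [d] the vertices around it. If [t]
    has no later neighbour, [c] centres a claw; if it has one beyond [d], then [t] centres a claw
    with leaf [t']; if exactly [d], the triangle [t c d] carries a net. *)
Lemma induced_path_fork (p : G) (Q : seq G) t t' : induced_path p Q -> uniq (p :: Q) ->
  t \notin p :: Q -> t' \notin p :: Q ->
  has (adj t) (p :: Q) -> ~~ adj t p -> ~~ adj t (last p Q) ->
  {in p :: Q &, forall c c', adj t c -> adj t c' -> c = c'} \/
    adj t t' /\ ~~ has (adj t') (p :: Q) ->
  has_heavy_pair [:: t, t', p & Q].
Proof.
move=> ipQ uQ tN t'N /split_first[L1 [c [L2 [QE tc L1N]]]] tp tl alt.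
case: L1 QE L1N => [|p' L1] [pE QE] L1N; first by rewrite pE tc in tp.
rewrite -{}pE in L1N.
case: L2 QE => [|d L2] QE; first by rewrite QE last_cat /= tc in tl.
have := ipQ; rewrite {1}QE => /induced_path_split[bc bN].
set b := last p L1 in bc bN *.
move=> /= /and3P[cd cN idL].
have bL1 : b \in p :: L1 by rewrite mem_last.
have [bd bL2] : ~~ adj b d /\ all (fun z => ~~ adj b z) L2 by apply/andP.
have tb : ~~ adj t b by apply: (hasPn L1N).
have memE z : z \in p :: Q = [|| z \in p :: L1, z == c, z == d | z \in L2].
  by rewrite QE -cat_cons mem_cat !inE.
have [bQ cQ dQ] : [/\ b \in p :: Q, c \in p :: Q & d \in p :: Q].
  by rewrite !memE bL1 !eqxx !orbT.
have neqt (x z : G) : z \in p :: Q -> x \notin p :: Q -> x != z.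
  by move=> zQ xN; apply: contraNneq xN => ->.
have [bnd cN2 dN2] : [/\ b != d, c \notin d :: L2 & d \notin L2].
  move: uQ; rewrite QE -cat_cons cat_uniq => /and3P[_ /hasPn dis /= /and3P[-> -> _]].
  split=> //; apply: contraTneq bL1 => ->; apply: dis.
  by rewrite !inE eqxx orbT.
have sub : {subset [:: t; t'; b; c; d] <= [:: t, t', p & Q]}.
  by move=> z; rewrite !in_cons in_nil orbF => /or4P[->|->|/eqP->|/orP[]/eqP->];
    rewrite ?orbT // -in_cons ?bQ ?cQ ?dQ !orbT.
have [|tL2] := boolP (has (adj t) (d :: L2)); last first.
  move: tL2; rewrite /= negb_or => /andP[td _].
  have h : has_heavy_pair [:: c; t; b; d].
    by apply: claw_heavy_pair; rewrite // 1?adj_sym // ?neqt.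
  apply: (has_heavy_pair_sub h) => z zs; apply: sub; move: zs.
  by rewrite !inE => /or4P[] ->; rewrite ?orbT.
case: alt => [un|[tt' t'L]] h.
  have [w wL tw] := hasP h.
  have wQ : w \in p :: Q by rewrite memE; move: wL; rewrite inE => /orP[]->; rewrite !orbT.
  by rewrite (un c w) ?wL in cN2.
have t'Q z : z \in p :: Q -> ~~ adj t' z by apply: (hasPn t'L).
have [/hasP[w wL tw]|tL2] := boolP (has (adj t) L2).
  have wQ : w \in p :: Q by rewrite memE wL !orbT.
  have cw : c != w by apply: contraNneq cN2 => ->; rewrite inE wL orbT.
  have h' : has_heavy_pair [:: t; c; w; t'].
    apply: claw_heavy_pair => //; try (by rewrite eq_sym neqt).
    + exact: (allP cN).
    + by rewrite adj_sym t'Q.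
    + by rewrite adj_sym t'Q.
  apply: (has_heavy_pair_sub h') => z; rewrite !inE => /or4P[] /eqP->; rewrite ?eqxx ?orbT //.
    by rewrite -in_cons cQ !orbT.
  by rewrite -in_cons wQ !orbT.
have td : adj t d by move: h; rewrite /= (negPf tL2) orbF.
(* As [t] is not adjacent to the end of the path, [d] has a successor [f], the third pendant vertex
   of the net. *)
case: L2 QE cN idL bL2 memE tL2 {bN cN2 dN2 h} => [|f L2] QE /= cN idL bL2 memE tL2.
  by rewrite QE last_cat /= td in tl.
have /and3P[df _ _] := idL; have /andP[cf _] := cN; have /andP[bf _] := bL2.
have fQ : f \in p :: Q by rewrite memE mem_head !orbT.
have h' : has_heavy_pair [:: t; c; d; t'; b; f].
  apply: net_heavy_pair => //; try (by rewrite adj_sym); try exact: t'Q;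
    try (by rewrite adj_sym t'Q).
  by move: tL2; rewrite negb_or => /andP[].
apply: (has_heavy_pair_sub h') => z; rewrite [z \in _]in_cons => /predU1P[->|].
  by rewrite mem_head.
rewrite 5!in_cons in_nil orbF => /or4P[/eqP->|/eqP->|/eqP->|/orP[]/eqP->];
  by rewrite !(in_cons t) !(in_cons t') ?eqxx ?orbT // ?cQ ?dQ ?bQ ?fQ !orbT.
Qed.

(** On an induced path from [p] to [q], either [r] itself forks off, with single neighbour [u], or
    the first vertex with a neighbour on the path, on the way from [r] through [u] back to [p],
    forks off. *)
Lemma pendants_heavy_pair (p q r u : G) s : path (@adj G) p (rcons s q) ->
  uniq (p :: rcons s q) -> r \notin p :: rcons s q -> u \in s -> adj r u ->
  ~~ adj p q -> ~~ adj p r -> ~~ adj q r ->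
  {in s, forall w, adj p w -> w = head u s} ->
  {in s, forall w, adj q w -> w = last u s} ->
  {in s, forall w, adj r w -> w = u} ->
  has_heavy_pair [:: p, q, r & s].
Proof.
move=> pth us rN us' ru pq pr qr hp hq hr.
have [Q [ipQ lQ uQ subQ]] := exists_induced_path pth us.
rewrite last_rcons in lQ.
have qp : q != p by move: us; rewrite /= mem_rcons inE negb_or eq_sym => /andP[/andP[]].
case: Q ipQ lQ uQ subQ => [|y Q] ipQ lQ uQ subQ; first by rewrite -lQ eqxx in qp.
have py : adj p y by case/and3P: ipQ.
have memL x : x \in p :: y :: Q -> [\/ x = p, x = q | x \in s].
  rewrite in_cons => /predU1P[->|/subQ]; first by constructor 1.
  by rewrite mem_rcons inE => /predU1P[->|]; [constructor 2|constructor 3].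
have ys : y \in s.
  have yQ : y \in p :: y :: Q by rewrite !inE eqxx orbT.
  have [yE|yE|//] := memL y yQ.
  - by rewrite yE adj_irr in py.
  - by rewrite yE (negPf pq) in py.
have sub x x' : x \in r :: s -> x' \in r :: s ->
    {subset [:: x, x', p, y & Q] <= [:: p, q, r & s]}.
  move=> xs xs' z; rewrite in_cons => /predU1P[->|].
    by rewrite !(in_cons p) !(in_cons q) xs !orbT.
  rewrite in_cons => /predU1P[->|]; first by rewrite !(in_cons p) !(in_cons q) xs' !orbT.
  by case/memL=> [->|->|zs]; rewrite !inE ?eqxx ?zs ?orbT.
have rL : r \notin p :: y :: Q.
  apply: contra rN => /memL[->|->|rs]; rewrite ?mem_head // in_cons mem_rcons in_cons ?eqxx ?rs ?orbT //.
have [hr'|hr'] := boolP (has (adj r) (p :: y :: Q)).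
  have runiq c : c \in p :: y :: Q -> adj r c -> c = u.
    case/memL=> [->|->|cs]; [by rewrite adj_sym (negPf pr)|by rewrite adj_sym (negPf qr)|exact: hr].
  have := @induced_path_fork p (y :: Q) r r ipQ uQ rL rL hr'.
  rewrite lQ adj_sym [adj r q]adj_sym => /(_ pr qr) h.
  apply: has_heavy_pair_sub (h _) (sub r r _ _); rewrite ?mem_head //.
  by left=> c c' cL cL' rc rc'; rewrite (runiq c cL rc) (runiq c' cL' rc').
have [s1 [s2 sE]] : exists s1 s2, s = s1 ++ u :: s2.
  by case/splitPr: us' => s1 s2; exists s1, s2.
have walk_back : path (@adj G) r (u :: rcons (rev s1) p).
  rewrite /= ru /=; apply: (link_rev (@adj_sym G)); move: pth.
  by rewrite /link sE rcons_cat rcons_path cat_path /= => /and3P[-> -> _].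
have hp' : has (adj p) (p :: y :: Q) by rewrite /= py orbT.
have [|t' [t [t's ts tt' t'N tL]]] :=
  path_first_hit (P := fun x => has (adj x) (p :: y :: Q)) walk_back hr'.
  by rewrite /= last_rcons.
(* If [t] were on the path, its predecessor [t'] would already have a neighbour there. *)
have tN : t \notin p :: y :: Q.
  by apply: contra t'N => tQ; apply/hasP; exists t.
have t'Q : t' \notin p :: y :: Q.
  by apply: contra t'N; apply: induced_path_nbr.
have in_s x : x \in u :: rcons (rev s1) p -> x \notin p :: y :: Q -> x \in s.
  rewrite in_cons mem_rcons in_cons mem_rev sE mem_cat [x \in u :: _]in_cons.
  by case/or3P=> [->|/eqP->|->]; rewrite ?mem_head ?orbT.
have tins := in_s _ ts tN.
have t'in : t' \in r :: s.
  move: t's; rewrite in_cons => /predU1P[->|/in_s/(_ t'Q) t's]; first exact: mem_head.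
  by rewrite in_cons t's orbT.
have lQin : last p (y :: Q) \in p :: y :: Q by rewrite mem_last.
apply: has_heavy_pair_sub (induced_path_fork (t := t) (t' := t') _ _ _ _ _ _ _ _) (sub _ _ _ _) => //.
(* The only neighbour of [p] in [s] is [y], which lies on the path; the next goal is the same for
   [q] and its predecessor. *)
- apply: contra tN; rewrite adj_sym => /(hp _ tins) ->.
  by rewrite -(hp y ys py) !inE eqxx orbT.
- rewrite lQ; apply: contra tN; rewrite adj_sym => qt.
  have [Q1 QE] : exists Q1, y :: Q = rcons Q1 q.
    by rewrite -lQ /= lastI; exists (belast y Q).
  have bq : adj (last p Q1) q by have := ipQ; rewrite QE -cats1 => /induced_path_split[].
  have bQ : last p Q1 \in p :: y :: Q.
    by rewrite QE -rcons_cons mem_rcons in_cons mem_last orbT.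
  have bs : last p Q1 \in s.
    have [bE|bE|//] := memL _ bQ; first by rewrite bE (negPf pq) in bq.
    by rewrite bE adj_irr in bq.
  by rewrite (hq _ tins qt) -(hq _ bs) // adj_sym.
- by right; rewrite adj_sym.
- by rewrite in_cons tins orbT.
Qed.

End Pendants.

(** * A bridge over a cycle of a 2-connected graph *)

Section Bridge.
Variable G : sgraph.
Hypothesis G2 : k_connected 2 G.
Implicit Types (x y z u v : G) (p q c : seq G).

Lemma path_avoiding (S : {set G}) x y : #|S| < 2 -> x \notin S -> y \notin S ->
  exists p, [/\ path (@adj G) x p, last x p = y & all (fun z => z \notin S) p].
Proof.
move=> S2 xS yS; have xC : x \in ~: S by rewrite inE.
have yC : y \in ~: S by rewrite inE.
have /connectP[p xp yE] := G2.2 S S2 (exist _ x xC) (exist _ y yC).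
exists (map val p); split.
- by have := @homo_path _ _ val (@adj (induced (~: S))) (@adj G)
    _ p (fun _ _ h => h) xp.
- by have := congr1 val yE; rewrite /= -(last_map val) => ->.
- by rewrite all_map; apply/allP=> -[z /= zC] _; rewrite inE in zC.
Qed.

Definition adj_off c : rel G := fun x y => [&& adj x y, x \notin c & y \notin c].

Lemma path_exit c x p : path (@adj G) x p -> x \notin c -> last x p \in c ->
  exists y z, [/\ connect (adj_off c) x y, z \in c, z \in p & adj y z].
Proof.
elim: p x => [|w p IH] x /=; first by move=> _ /negPf ->.
case/andP=> xw wp xc lc; have [wc|wc] := boolP (w \in c).
  by exists x, w; rewrite mem_head connect0.
have [y [z [wy zc zp yz]]] := IH w wp wc lc.
exists y, z; rewrite in_cons zp orbT; split=> //.
by apply: connect_trans wy; apply: connect1; rewrite /adj_off xw xc wc.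
Qed.

Lemma path_adj_off c x p : path (adj_off c) x p -> all (fun z => z \notin c) p.
Proof. by elim: p x => //= y p IH x /andP[/and3P[_ _ ->] /IH]. Qed.

(** One path from [x] meets [c] at [u]; a second one, avoiding [u], meets it at [v]. The vertices
    before these hits lie in one component outside [c], and a simple path there joins them. *)
Lemma exists_bridge c x : uniq c -> 1 < size c -> x \notin c ->
  exists u v P, [/\ u \in c, v \in c, u != v & path (@adj G) u (rcons P v)] /\
    [/\ uniq P, 0 < size P & all (fun z => z \notin c) P].
Proof.
case: c => [|a [|b c]] // uc _ xc; set C := [:: a, b & c] in uc xc *.
have [|||p [xp lp _]] := @path_avoiding set0 x a; rewrite ?cards0 ?inE //.
have [|y0 [u [xy0 uC _ y0u]]] := path_exit xp xc; first by rewrite lp mem_head.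
have [d dC du] : exists2 d, d \in C & d != u.
  have [bu|bu] := eqVneq b u; last by exists b; rewrite // !inE eqxx orbT.
  exists a; first exact: mem_head.
  by apply: contraTneq uc => au; rewrite /C /= -au in bu *; rewrite -bu mem_head.
have xu : x != u by apply: contraNneq xc => ->.
have [|||q [xq lq qu]] := @path_avoiding [set u] x d; rewrite ?cards1 ?inE //.
have [|y1 [v [xy1 vC vq y1v]]] := path_exit xq xc; first by rewrite lq.
have uv : u != v by have := allP qu v vq; rewrite inE eq_sym.
have off_sym : connect_sym (adj_off C).
  by apply: sym_connect_sym => y z; rewrite /adj_off adj_sym andbCA andbC -andbA.
have /connectP[r] : connect (adj_off C) y0 y1.
  by apply: connect_trans xy1; rewrite off_sym.
case/shortenP=> r' y0r ur _ ly1.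
have y0C : y0 \notin C.
  have /connectP[t xt ->] := xy0.
  by case/lastP: t xt => // t z; rewrite rcons_path last_rcons => /andP[_ /and3P[]].
exists u, v, (y0 :: r'); split; split=> //.
- rewrite /= rcons_path -ly1 y1v adj_sym y0u /= andbT.
  by apply: sub_path y0r => y z /and3P[].
- by rewrite /= y0C (path_adj_off y0r).
Qed.

End Bridge.

(** * Growing the blocks and counting degrees *)

Section Hamilton.
Variable G : sgraph.
Hypothesis claw_heavy : is_heavy G claw.
Hypothesis net_heavy : is_heavy G net.
Variable m : nat.
Hypothesis cycle_bound : forall c, cycle (@adj G) c -> uniq c -> size c <= m.
Implicit Types (x y z u v a b w : G) (X Y P : seq G).

Lemma hadj_cycle_bound c : cycle (@hadj G) c -> uniq c -> size c <= m.
Proof.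
move=> cc uc; have [c' [cc' uc' le]] := adj_cycle_of_hadj_cycle cc uc.
exact: leq_trans le (cycle_bound cc' uc').
Qed.

Local Notation frame := (frame (@hadj G) m).

(** Growth only divides the same cycle anew. Its steps and those of the bridge stay genuine edges,
    as is required to find induced claws and nets. *)
Lemma frame_grow u v Du X Dv Y P : frame u v Du X Dv Y P ->
  cycle (@adj G) (Du ++ X ++ Dv ++ Y) -> path (@adj G) u (rcons P v) ->
  ~ has_heavy_pair Du ->
  exists Du' X' Y', [/\ frame u v Du' X' Dv Y' P,
    cycle (@adj G) (Du' ++ X' ++ Dv ++ Y') & size X' + size Y' < size X + size Y].
Proof.
move=> fr cyc uP nohp.
have hs := @hadj_sym G; have hb := hadj_cycle_bound.
have X0 := frame_gapX hs hb fr; have Y0 := frame_gapY hs hb fr.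
case: X fr cyc X0 => [//|b X] fr cyc _.
case/lastP: Y fr cyc Y0 => [//|Y a] fr cyc _.
have cyc' : cycle (@adj G) (a :: Du ++ (b :: X) ++ Dv ++ Y).
  by rewrite -rotr1_rcons rotr_cycle !rcons_cat.
have [/hasP[w wD /andP[wl wb]]|nob] :=
  boolP (has (fun w => (w != last u Du) && hadj w b) Du).
  exists (rcons Du b), X, (rcons Y a); split; last by rewrite /=; lia.
  - exact: (frame_growX fr wD wl wb).
  - by rewrite cat_rcons.
have [/hasP[w wD /andP[wl wa]]|noa] :=
  boolP (has (fun w => (w != head u Du) && hadj w a) Du).
  exists (a :: Du), (b :: X), Y; split=> //; last by rewrite size_rcons; lia.
  exact: (frame_growY hs fr wD wl wa).
have [ab|nab] := boolP (hadj a b).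
  exists (a :: rcons Du b), X, Y; split; last by rewrite size_rcons /=; lia.
  - exact: (frame_growXY fr ab).
  - by rewrite cat_cons cat_rcons.
case: P fr uP => [|z P] fr uP; first by case: fr.
have uz : adj u z by case/andP: uP.
have zP : z \in z :: P by rewrite mem_head.
have uD := block_mem (frame_blockl fr).
(* No growth is possible, so [a], [b] and [z] have one heavy neighbour each in [Du] and none among
   themselves. *)
have adjA w : w \in Du -> hadj a w -> w = head u Du.
  move=> wD aw; apply/eqP; apply: contraNT noa => wh.
  by apply/hasP; exists w; rewrite // wh hadj_sym.
have adjB w : w \in Du -> hadj b w -> w = last u Du.
  move=> wD aw; apply/eqP; apply: contraNT nob => wh.
  by apply/hasP; exists w; rewrite // wh hadj_sym.
have adjZ w : w \in Du -> hadj z w -> w = u.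
  by move=> wD zw; apply: (frame_bridge_block hs hb fr zP (adj_hadj uz) wD zw).
have nza : ~~ hadj z a.
  by apply/negP; apply: (frame_bridge_gapY hs hb fr zP (adj_hadj uz)).
have nzb : ~~ hadj z b.
  by apply/negP; apply: (frame_bridge_gapX hs hb fr zP (adj_hadj uz)).
have nadj x y : ~~ hadj x y -> ~~ adj x y by apply: contra; apply: adj_hadj.
have apath : path (@adj G) a (rcons Du b).
  move: cyc'; rewrite /= rcons_cat cat_path /= => /and3P[aD Db _].
  by rewrite rcons_path aD.
have aD : adj a (head u Du).
  by case: (Du) apath uD => //= d D /andP[].
have bD : adj b (last u Du).
  by move: apath; rewrite rcons_path adj_sym; case: (Du) uD => //= d D _ /andP[].
have uabD : uniq [:: z, a & rcons Du b].
  have := frame_uniq fr; rewrite (perm_uniq (_ : perm_eq _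
    ([:: z, a & rcons Du b] ++ X ++ Dv ++ Y ++ P))); last by perm_count.
  by rewrite cat_uniq => /andP[].
have [x [y [xs ys /and3P[xy nxy deg]]]] : has_heavy_pair [:: a, b, z & Du].
  move: uabD; rewrite cons_uniq => /andP[zN uN].
  apply: (pendants_heavy_pair claw_heavy net_heavy (u := u)) => //.
  - by rewrite adj_sym.
  - exact: nadj.
  - by apply: nadj; rewrite hadj_sym.
  - by apply: nadj; rewrite hadj_sym.
  - by move=> w wD /adj_hadj; apply: adjA.
  - by move=> w wD /adj_hadj; apply: adjB.
  - by move=> w wD /adj_hadj; apply: adjZ.
(* All heavy adjacencies of [a], [b], [z] seen here are edges, so a heavy pair, being nonadjacent,
   must lie inside [Du]. *)
have pend x1 y1 : x1 \in [:: a; b; z] -> y1 \in [:: a, b, z & Du] ->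
    hadj x1 y1 -> adj x1 y1.
  rewrite 3![y1 \in _]in_cons.
  rewrite !inE => /or3P[]/eqP-> /or4P[/eqP->|/eqP->|/eqP->|yD] h;
    try (by rewrite /hadj eqxx in h);
    try (by move: nab nza nzb; rewrite ?h // hadj_sym h);
    try (by move: nab nza nzb; rewrite [hadj z _]hadj_sym ?h // [hadj z _]hadj_sym h).
  - by rewrite (adjA _ yD h).
  - by rewrite (adjB _ yD h).
  - by rewrite (adjZ _ yD h) adj_sym.
have hxy : hadj x y by rewrite /hadj xy deg orbT.
have inD x1 : x1 \in [:: a, b, z & Du] -> x1 \in [:: a; b; z] \/ x1 \in Du.
  by rewrite !inE => /or4P[]->; rewrite ?orbT; auto.
case: nohp; exists x, y; rewrite /heavy_pair xy nxy deg; split=> //.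
  by case: (inD x xs) => // /pend/(_ ys hxy); rewrite (negPf nxy).
case: (inD y ys) => // /pend/(_ xs); rewrite hadj_sym hxy adj_sym => /(_ isT).
by rewrite (negPf nxy).
Qed.

(** By induction on the total size of the gaps, which growth reduces, both blocks contain heavy
    pairs; their degrees force cross edges that are not a matching. *)
Lemma no_frame u v Du X Dv Y P : frame u v Du X Dv Y P ->
  cycle (@adj G) (Du ++ X ++ Dv ++ Y) -> path (@adj G) u (rcons P v) -> False.
Proof.
have hs := @hadj_sym G; have hb := hadj_cycle_bound.
have [N] := ubnP (size X + size Y).
elim: N Du X Dv Y => // N IH Du X Dv Y; rewrite ltnS => leN fr cyc uP.
have hpu : ~ ~ has_heavy_pair Du.
  move=> /(frame_grow fr cyc uP)[Du' [X' [Y' [fr' cyc' lt]]]].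
  exact: (IH _ _ _ _ (leq_trans lt leN) fr' cyc' uP).
have hpv : ~ ~ has_heavy_pair Dv.
  have cycv : cycle (@adj G) (Dv ++ Y ++ Du ++ X).
    by move: cyc; rewrite catA -(rot_cycle (size (Du ++ X))) rot_size_cat -catA.
  have vP : path (@adj G) v (rcons (rev P) u) by apply: (link_rev (@adj_sym G)).
  move=> /(frame_grow (frame_swap hs fr) cycv vP)[Dv' [Y' [X' [fr' cyc' lt]]]].
  have fr2 := frame_swap hs fr'; rewrite revK in fr2.
  apply: (IH _ _ _ _ _ fr2 _ uP); first by move: lt leN; lia.
  by move: cyc'; rewrite catA -(rot_cycle (size (Dv' ++ Y'))) rot_size_cat -catA.
apply: hpu => -[x [x' [xD xD' /and3P[xx nxx dx]]]].
apply: hpv => -[y [y' [yD yD' /and3P[yy nyy dy]]]].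
have dis x1 y1 : x1 \in Du -> y1 \in Dv -> x1 != y1.
  move=> h1 h2; have := frame_uniq fr; rewrite cat_uniq => /and3P[_ /hasPn dis _].
  apply: contraTneq h1 => ->; apply: dis; by rewrite !mem_cat h2 orbT.
have cross x1 y1 : x1 \in Du -> y1 \in Dv -> #|G| <= degree x1 + degree y1 -> hadj x1 y1.
  by move=> h1 h2 d; rewrite /hadj (dis _ _ h1 h2) d orbT.
apply: (frame_cross_rect hs hb fr xD xD' yD yD' xx yy); apply/orP.
(* The four degrees add up to at least [2 * #|G|], so each way of pairing them across the blocks has
   a pair reaching [#|G|]. *)
- have [d|d] : #|G| <= degree x + degree y \/ #|G| <= degree x' + degree y' by lia.
    by left; apply: cross.
  by right; apply: cross.
- have [d|d] : #|G| <= degree x + degree y' \/ #|G| <= degree x' + degree y by lia.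
    by left; apply: cross.
  by right; apply: cross.
Qed.
End Hamilton.

(** * Longest cycles and the conclusion *)

Lemma exists_longest_cycle (G : sgraph) : exists c : seq G,
  [/\ cycle (@adj G) c, uniq c &
      forall c', cycle (@adj G) c' -> uniq c' -> size c' <= size c].
Proof.
pose P k := [exists t : k.-tuple G, cycle (@adj G) t && uniq t].
have exP : exists k, P k by exists 0; apply/existsP; exists [tuple].
have leP k : P k -> k <= #|G|.
  by case/existsP=> t /andP[_ /card_uniqP]; rewrite size_tuple => <-; apply: max_card.
case: (ex_maxnP exP leP) => k /existsP[t /andP[ct ut]] maxk.
exists t; split=> // c cc uc; rewrite size_tuple; apply: maxk.
by apply/existsP; exists (in_tuple c); rewrite cc uc.
Qed.

Theorem theorem4 (G : sgraph) :
  k_connected 2 G ->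
  family_heavy G (fun H => H = claw \/ H = net) ->
  hamiltonian G.
Proof.
move=> G2 fam.
have claw_heavy : is_heavy G claw by apply: fam; left.
have net_heavy : is_heavy G net by apply: fam; right.
have [c [cc uc maxc]] := exists_longest_cycle G.
have n3 : 2 < #|G| := G2.1.
(* For [cycle] an edge traversed back and forth counts, so any edge bounds the length below by 2. *)
have c2 : 1 < size c.
  have /card_gt1P[x [y [_ _ xy]]] : 1 < #|G| by apply: ltnW.
  have [|||p [xp lp _]] := @path_avoiding G G2 set0 x y; rewrite ?cards0 ?inE //.
  case: p xp lp => [|z p] /= => [_ xE|/andP[xz _] _]; first by rewrite xE eqxx in xy.
  apply: (maxc [:: x; z]); first by rewrite /= xz adj_sym xz.
  by rewrite /= mem_seq1 (adj_neq xz).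
have [all_c|] := boolP [forall x, x \in c].
  exists c; split; last by move=> x; apply: (forallP all_c).
    rewrite -(card_uniqP uc); apply: leq_trans n3 _; apply/subset_leq_card/subsetP=> x _.
    exact: (forallP all_c).
  by rewrite /ucycle cc uc.
rewrite negb_forall => /existsP[x xc]; exfalso.
have [u [v [P [[uC vC uv uP] [uniqP P0 offP]]]]] := exists_bridge G2 uc c2 xc.
have [i s rE] := rot_to uC.
have vs : v \in s.
  by move: vC; rewrite -(mem_rot i) rE in_cons eq_sym (negPf uv).
have [X [Y sE]] : exists X Y, s = X ++ v :: Y by case/splitPr: vs => X Y; exists X, Y.
have cE : [:: u] ++ X ++ [:: v] ++ Y = rot i c by rewrite rE sE.
have cyc : cycle (@adj G) ([:: u] ++ X ++ [:: v] ++ Y) by rewrite cE rot_cycle.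
(* The initial frame has the one-vertex blocks [[:: u]] and [[:: v]]. *)
apply: (no_frame claw_heavy net_heavy maxc (u := u) (v := v) (P := P) _ cyc uP).
have sub p y : path (@adj G) y p -> path (@hadj G) y p by apply: sub_path; apply: adj_hadj.
have := sub _ _ cyc; rewrite /= rcons_cat cat_path /= => /and3P[uX Xv vY].
split=> //.
- exact: Block1.
- exact: Block1.
- by rewrite /link rcons_path uX.
- exact: sub.
- rewrite !catA cat_uniq -!catA cE rot_uniq uc uniqP andbT /=.
  apply/hasPn=> z zP; rewrite mem_rot; exact: (allP offP).
- by rewrite cE size_rot.
Qed.
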